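(* Let $Y$ be a real vector space, $A$ a nonempty proper subset of $Y$ and $k\in Y\setminus\{0\}$. (I) (a) If $A$ is convex, then $\varphi_{A,k}$ is convex. (b) If $A$ is a cone, then $\varphi_{A,k}$ is positively homogeneous. (c) If $A+A\subseteq A$, then $\varphi_{A,k}$ is subadditive. (d) If $A$ is a convex cone, then $\varphi_{A,k}$ is sublinear. (II) Suppose that $A$ is $k$-directionally closed and $k\in-0^+A$. Then each of the sufficient conditions given in (I) is also necessary, i.e.: $\varphi_{A,k}$ is convex if and only if $A$ is convex; $\varphi_{A,k}$ is positively homogeneous if and only if $A$ is a cone; $\varphi_{A,k}$ is subadditive if and only if $A+A\subseteq A$; $\varphi_{A,k}$ is sublinear if and only if $A$ is a convex cone. Moreover, $\varphi_{A,k}$ is quasiconvex if and only if $\varphi_{A,k}$ is convex.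
   Context: Let $\nu$ be a symbol not in $\overline{\mathbb{R}}=\mathbb{R}\cup\{-\infty,+\infty\}$, not comparable with real numbers, and $\overline{\mathbb{R}}_\nu:=\overline{\mathbb{R}}\cup\{\nu\}$; $\inf\emptyset:=\nu$. For nonempty $A\subseteq Y$, $k\in Y\setminus\{0\}$, $\varphi_{A,k}:Y\to\overline{\mathbb{R}}_\nu$ is $\varphi_{A,k}(y):=\inf\{t\in\mathbb{R}\mid y\in A+tk\}$ ($-\infty$ if unbounded below); $\operatorname{dom}\varphi_{A,k}=\{y\in Y\mid\varphi_{A,k}(y)\in\mathbb{R}\cup\{-\infty\}\}$. A set $C\subseteq Y$ is a cone iff $\lambda c\in C$ for all $\lambda\in[0,\infty)$, $c\in C$ (the same definition is used in $Y\times\mathbb{R}$). The epigraph of $\varphi:Y\to\overline{\mathbb{R}}_\nu$ is $\operatorname{epi}\varphi=\{(y,t)\in Y\times\mathbb{R}\mid\varphi(y)\le t\}$. The function $\varphi=\varphi_{A,k}$ (which never takes the value $+\infty$) is called convex iff $\operatorname{epi}\varphi$ is convex; positively homogeneous iff $\operatorname{epi}\varphi$ is a cone; subadditive iff $\operatorname{epi}\varphi+\operatorname{epi}\varphi\subseteq\operatorname{epi}\varphi$; sublinear iff it is convex and positively homogeneous; quasiconvex iff $\operatorname{dom}\varphi$ is convex and $\varphi(\lambda y^1+(1-\lambda)y^2)\le\max(\varphi(y^1),\varphi(y^2))$ for all $y^1,y^2\in\operatorname{dom}\varphi$, $\lambda\in(0,1)$. The recession cone of $A$ is $0^+A:=\{u\in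 Y\mid\forall a\in A\ \forall t\in[0,\infty):\ a+tu\in A\}$. $A$ is $k$-directionally closed if for every $y\in Y$: whenever there is a sequence $(t_n)$ of positive reals decreasing to $0$ with $y-t_nk\in A$ for all $n$, then $y\in A$. *)

(* Defs.v *)
From HB Require Import structures.
From mathcomp Require Import all_boot all_order all_algebra.
From mathcomp Require Import boolp classical_sets functions reals ereal topology.
From mathcomp Require Import normedtype sequences convex.

Set Implicit Arguments.
Unset Strict Implicit.
Unset Printing Implicit Defensive.

Import Order.TTheory GRing.Theory Num.Theory.
Import numFieldNormedType.Exports.

Local Open Scope classical_set_scope.
Local Open Scope ring_scope.

(* [None] is the symbol nu, which is the infimum of the empty set. *)
Definition ereal_nu (R : realType) : Type := option (\bar R).

Definition le_nu (R : realType) (u v : ereal_nu R) : Prop :=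
  match u, v with
  | Some x, Some y => (x <= y)%E
  | _, _ => False
  end.

(* Only meant for arguments different from nu. *)
Definition max_nu (R : realType) (u v : ereal_nu R) : ereal_nu R :=
  match u, v with
  | Some x, Some y => Some (Order.max x y)
  | _, _ => None
  end.

Definition inf_nu (R : realType) (S : set R) : ereal_nu R :=
  if `[< S = set0 >] then None else Some (ereal_inf (EFin @` S)).

Definition sumset (R : realType) (V : lmodType R) (A B : set V) : set V :=
  [set a + b | a in A & b in B].

Definition phi (R : realType) (Y : lmodType R) (A : set Y) (k : Y) (y : Y) :
    ereal_nu R :=
  inf_nu [set t : R | sumset A [set t *: k] y].

Definition dom_nu (R : realType) (Y : lmodType R) (f : Y -> ereal_nu R) : set Y :=
  [set y | exists2 x : \bar R, f y = Some x & x != +oo%E].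

(* [R^o] makes the product Y x R a vector space over R. *)
Definition epi_nu (R : realType) (Y : lmodType R) (f : Y -> ereal_nu R) :
    set (Y * R^o)%type :=
  [set p | le_nu (f p.1) (Some p.2%:E)].

(* 0 belongs to every nonempty cone, while the empty set is a cone. *)
Definition cone (R : realType) (V : lmodType R) (C : set V) : Prop :=
  forall (l : R) (c : V), 0 <= l -> C c -> C (l *: c).

(* The epigraph-based notions below are the standard ones for functions that
   do not take the value +oo, as is the case for [phi A k]. *)
Definition convex_nu (R : realType) (Y : lmodType R) (f : Y -> ereal_nu R) :
    Prop :=
  convex_set (epi_nu f).

Definition pos_homogeneous_nu (R : realType) (Y : lmodType R)
    (f : Y -> ereal_nu R) : Prop :=
  cone (epi_nu f).

Definition subadditive_nu (R : realType) (Y : lmodType R)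
    (f : Y -> ereal_nu R) : Prop :=
  sumset (epi_nu f) (epi_nu f) `<=` epi_nu f.

Definition sublinear_nu (R : realType) (Y : lmodType R) (f : Y -> ereal_nu R) :
    Prop :=
  convex_nu f /\ pos_homogeneous_nu f.

Definition quasiconvex_nu (R : realType) (Y : lmodType R) (f : Y -> ereal_nu R) :
    Prop :=
  convex_set (dom_nu f) /\
  forall (y1 y2 : Y) (l : R), dom_nu f y1 -> dom_nu f y2 -> 0 < l < 1 ->
    le_nu (f (l *: y1 + (1 - l) *: y2)) (max_nu (f y1) (f y2)).

Definition recession_cone (R : realType) (Y : lmodType R) (A : set Y) : set Y :=
  [set u | forall (a : Y) (t : R), A a -> 0 <= t -> A (a + t *: u)].

(* "Decreasing" is taken in the weak sense; since the terms are positive and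
   tend to 0, passing to a subsequence makes the sequence strictly decreasing,
   so both readings define the same sets. *)
Definition directionally_closed (R : realType) (Y : lmodType R) (k : Y)
    (A : set Y) : Prop :=
  forall y : Y,
    (exists t : R^nat,
      [/\ forall n, 0 < t n,
          nonincreasing_seq t,
          t @ \oo --> 0
        & forall n, A (y - t n *: k)]) ->
    A y.

(* Main.v *)
Require Import Defs.
From HB Require Import structures.
From mathcomp Require Import all_boot all_order all_algebra.
From mathcomp Require Import boolp classical_sets functions reals ereal topology.
From mathcomp Require Import normedtype sequences convex.
From mathcomp Require Import interval_inference lra.

Set Implicit Arguments.
Unset Strict Implicit.
Unset Printing Implicit Defensive.

Import Order.TTheory GRing.Theory Num.Theory.
Import numFieldNormedType.Exports.

Local Open Scope classical_set_scope.
Local Open Scope ring_scope.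

(** Consider the preimage [T] of [A] under the linear map
    [(y, t) |-> y - t *: k].  It is convex, a cone, or closed under addition
    as soon as [A] is.  The epigraph of [phi A k] consists of the points
    [(y, s)] such that, for every [e > 0], [T] contains some [(y, t)] with
    [t < s + e] (lemma [epi_phiP]), and passing from [T] to this set keeps
    each of the three properties.  That is part (I).

    If [k] is the opposite of a recession direction, [T] is closed upwards
    in the vertical direction, and if [A] is [k]-directionally closed, [T] is
    closed under passing to the limit downwards.  Both together make the
    epigraph equal to [T] (lemma [epi_phi_closedP]).  In particular [A] is the
    section of the epigraph at height 0, that is, the sublevel set
    [phi A k <= 0].  Convexity, the cone property and closedness under
    addition pass from the epigraph to this section, which gives the converse
    implications.  Quasiconvexity makes sublevel sets convex, so it already
    forces [A] to be convex, and then [phi A k] is convex by part (I);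
    conversely, a convex function into the extended reals is always
    quasiconvex. *)

(** The coefficients 0 and 1 give back the endpoints; leaving them out matches
    the range of coefficients in the definition of quasiconvexity. *)
Lemma convex_setP (R : realType) (V : lmodType R) (C : set V) :
  convex_set C <->
  (forall (x y : V) (l : R), 0 < l < 1 -> C x -> C y ->
    C (l *: x + (1 - l) *: y)).
Proof.
rewrite convex_setW; split => [cC x y l /andP[l0 l1] Cx Cy|cC x y].
  have := cC x y (mem_set Cx) (mem_set Cy) (Itv01 (ltW l0) (ltW l1)) l0 l1.
  by rewrite inE.
rewrite !inE => Cx Cy l l0 l1; apply/mem_set.
have l01 : 0 < l%:num < 1 by rewrite l0 l1.
exact: cC l01 Cx Cy.
Qed.

Section nu_functions.
Context (R : realType) (Y : lmodType R).
Implicit Type f : Y -> ereal_nu R.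

Lemma dom_nuP f y : dom_nu f y <-> exists s : R, epi_nu f (y, s).
Proof.
rewrite /dom_nu /epi_nu /=; split => [[x -> xoo]|[s]].
  case: x xoo => [r| |] // _; first by exists r => /=.
  by exists 0; rewrite /= leNye.
case: (f y) => //= x xs; exists x => //.
by rewrite -ltey (le_lt_trans xs) ?ltry.
Qed.

(** An inequality between elements different from [nu] can be tested on real
    upper bounds; [M <> +oo] ensures that there is one, so that the case where
    the left-hand side is [nu] is excluded. *)
Lemma le_nu_real (u : ereal_nu R) (M : \bar R) : M != +oo%E ->
  (forall s : R, (M <= s%:E)%E -> le_nu u (Some s%:E)) -> le_nu u (Some M).
Proof.
case: M => [r| |] // _ uM; first exact: uM.
case: u uM => [x|] uM /=; last exact: uM 0 (leNye _).
rewrite leeNy_eq; apply/eqP/eq_ninfty => s.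
by apply: uM; rewrite leNye.
Qed.

(** Points of a sublevel set at real height lie in the domain, so the
    quasiconvexity inequality applies to them. *)
Lemma quasiconvex_sublevel f (s : R) :
  quasiconvex_nu f -> convex_set [set y | epi_nu f (y, s)].
Proof.
move=> [_ qf]; apply/convex_setP => y1 y2 l l01 /= h1 h2.
have {qf} := qf y1 y2 l _ _ l01.
move=> /(_ (proj2 (dom_nuP _ _) (ex_intro _ s h1))).
move=> /(_ (proj2 (dom_nuP _ _) (ex_intro _ s h2))).
move: h1 h2; rewrite /epi_nu /=.
case: (f y1) => //= x1; case: (f y2) => //= x2 x1s x2s.
case: (f _) => //= x /le_trans; apply.
by rewrite ge_max x1s.
Qed.

(** Any real [s] above both values puts the two points into the epigraph at
    the same height [s], and convexity keeps that height.  When both values are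
    [-oo], every real [s] qualifies, which is why the bound is obtained through
    [le_nu_real] rather than from a single [s]. *)
Lemma convex_quasiconvex f : convex_nu f -> quasiconvex_nu f.
Proof.
move=> /convex_setP cf.
have dom_convex : convex_set (dom_nu f).
  apply/convex_setP => y1 y2 l l01 /dom_nuP[s1 h1] /dom_nuP[s2 h2].
  by apply/dom_nuP; exists (l * s1 + (1 - l) * s2); exact: cf h1 h2.
split=> // y1 y2 l [x1 fy1 x1oo] [x2 fy2 x2oo] l01.
rewrite fy1 fy2 /=; apply: le_nu_real.
  by rewrite -!ltey in x1oo x2oo *; rewrite gt_max x1oo.
move=> s; rewrite ge_max => /andP[x1s x2s].
have -> : s = l * s + (1 - l) * s by lra.
by apply: (cf (y1, s) (y2, s)) => //; rewrite /epi_nu /= ?fy1 ?fy2.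
Qed.

End nu_functions.

Section epigraph.
Context (R : realType) (Y : lmodType R) (k : Y).
Implicit Type A : set Y.

Lemma epi_phiP A y (s : R) :
  epi_nu (phi A k) (y, s) <->
  (forall e : R, 0 < e -> exists2 t : R, t < s + e & A (y - t *: k)).
Proof.
have mem_translate (t : R) : sumset A [set t *: k] y <-> A (y - t *: k).
  split => [[a Aa [_ -> <-]]|Ay]; first by rewrite addrK.
  by exists (y - t *: k) => //; exists (t *: k) => //; rewrite subrK.
rewrite /epi_nu /phi /inf_nu /=; case: asboolP => [S0|/eqP/set0P _] /=.
  split=> // /(_ 1 ltr01) [t _ /mem_translate Sy].
  by suff: (set0 : set R) t by []; rewrite -S0.
split=> [infs e e0|approx].
  have /ereal_inf_lt[_ [t /mem_translate At <-]] :
      (ereal_inf (EFin @` [set t | sumset A [set t *: k] y]) < (s + e)%:E)%E.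
    by rewrite (le_lt_trans infs)// lte_fin ltrDl.
  by rewrite lte_fin => ts; exists t.
apply/lee_addgt0Pr => e e0; apply: ge_ereal_inf.
have [t ts /mem_translate At] := approx e e0.
by exists t%:E; [exists t | rewrite -EFinD lee_fin ltW].
Qed.

Lemma phi_convex A : convex_set A -> convex_nu (phi A k).
Proof.
move=> /convex_setP cA.
apply/convex_setP => -[y1 s1] [y2 s2] l l01 /epi_phiP h1 /epi_phiP h2.
apply/epi_phiP => e e0.
have [t1 t1s At1] := h1 e e0; have [t2 t2s At2] := h2 e e0.
have /andP[l0 l1] := l01.
exists (l * t1 + (1 - l) * t2) => /=.
  rewrite -[l *: _]/(l * s1) -[_ *: _]/((1 - l) * s2).
  have -> : l * s1 + (1 - l) * s2 + e =
      l * (s1 + e) + (1 - l) * (s2 + e) by lra.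
  by rewrite ltrD ?ltr_pM2l ?subr_gt0.
have -> : l *: y1 + (1 - l) *: y2 - (l * t1 + (1 - l) * t2) *: k =
    l *: (y1 - t1 *: k) + (1 - l) *: (y2 - t2 *: k).
  by rewrite [X in _ - X]scalerDl -!scalerA !scalerBr opprD addrACA.
exact: cA.
Qed.

Lemma phi_pos_homogeneous A : cone A -> pos_homogeneous_nu (phi A k).
Proof.
move=> coneA l [y s] l_ge0 /epi_phiP h; apply/epi_phiP => e e0 /=.
rewrite -[l *: s]/(l * s).
have [l0|l_neq0] := eqVneq l 0.
  (* The hypothesis on (y, s) still matters here: it provides an element of A,
     hence 0 \in A. *)
  have [t _ At] := h 1 ltr01; rewrite l0 scale0r mul0r add0r.
  by exists 0; rewrite // scale0r subr0 -(scale0r (y - t *: k)); exact: coneA.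
have l_gt0 : 0 < l by rewrite lt_neqAle eq_sym l_neq0.
have [t ts At] := h (e / l) (divr_gt0 e0 l_gt0).
exists (l * t).
  by rewrite -(ltr_pM2l l_gt0) mulrDr mulrCA divff// mulr1 in ts.
by rewrite -scalerA -scalerBr; exact: coneA.
Qed.

Lemma phi_subadditive A : sumset A A `<=` A -> subadditive_nu (phi A k).
Proof.
move=> addA _ [[y1 s1] /epi_phiP h1 [[y2 s2] /epi_phiP h2 <-]].
apply/epi_phiP => e e0 /=.
have e20 : 0 < e / 2 by rewrite divr_gt0.
have [t1 t1s At1] := h1 _ e20; have [t2 t2s At2] := h2 _ e20.
exists (t1 + t2); first by rewrite [e]splitr addrACA ltrD.
by apply: addA; exists (y1 - t1 *: k) => //; exists (y2 - t2 *: k) => //;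
  rewrite scalerDl opprD addrACA.
Qed.

(** Directional closedness may be tested on all small steps instead of on one
    sequence, as the harmonic sequence is an admissible choice. *)
Lemma directionally_closed_gt0 A y :
  directionally_closed k A -> (forall e : R, 0 < e -> A (y - e *: k)) -> A y.
Proof.
move=> clA Ay; apply: clA; exists (@harmonic R); split.
- by move=> n; rewrite /= invr_gt0.
- by move=> m n mn; rewrite /= lef_pV2 ?posrE// ler_nat.
- exact: cvg_harmonic.
- by move=> n; apply: Ay; rewrite /= invr_gt0.
Qed.

(** From [(y, t)] with [t < s + e] the recession direction [- k] leads up to
    height [s + e], and directional closedness allows [e] to tend to 0. *)
Lemma epi_phi_closedP A y (s : R) :
  directionally_closed k A -> [set - u | u in recession_cone A] k ->
  epi_nu (phi A k) (y, s) <-> A (y - s *: k).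
Proof.
move=> clA [u recu uk]; rewrite epi_phiP; split => [h|Ay e e0]; last first.
  by exists s => //; rewrite ltrDl.
apply: directionally_closed_gt0 => // e e0; have [t ts At] := h e e0.
have -> : y - s *: k - e *: k = (y - t *: k) + (s + e - t) *: u.
  by rewrite -uk !scalerN !opprK scalerBl scalerDl !addrA -!addrA; congr +%R;
    rewrite [RHS]addrC !addrA subrK.
by apply: recu => //; rewrite subr_ge0 ltW.
Qed.

End epigraph.

Section necessity.
Context (R : realType) (Y : lmodType R) (A : set Y) (k : Y).
Context (A_section : forall y : Y, epi_nu (phi A k) (y, 0 : R) <-> A y).

Lemma quasiconvex_phi_convex : quasiconvex_nu (phi A k) -> convex_set A.
Proof.
move=> /(@quasiconvex_sublevel _ _ _ 0).
by congr convex_set; apply/seteqP; split => y /A_section.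
Qed.

Lemma pos_homogeneous_phi_cone : pos_homogeneous_nu (phi A k) -> cone A.
Proof.
move=> cf l y l0 /A_section Ay; apply/A_section.
by rewrite -[X in (_, X)](scaler0 R^o l); exact: cf Ay.
Qed.

Lemma subadditive_phi_add : subadditive_nu (phi A k) -> sumset A A `<=` A.
Proof.
move=> addf _ [y1 /A_section Ay1 [y2 /A_section Ay2 <-]]; apply/A_section.
apply: addf; exists (y1, 0) => //; exists (y2, 0) => //.
by congr pair; exact: addr0.
Qed.

End necessity.

Theorem theorem3 (R : realType) (Y : lmodType R) (A : set Y) (k : Y)
    (A_nonempty : A !=set0) (A_proper : A `<` setT) (k_neq0 : k != 0) :
  [/\ convex_set A -> convex_nu (phi A k),
      cone A -> pos_homogeneous_nu (phi A k),
      sumset A A `<=` A -> subadditive_nu (phi A k)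
    & convex_set A /\ cone A -> sublinear_nu (phi A k)]
  /\
  (directionally_closed k A ->
   [set - u | u in recession_cone A] k ->
   [/\ convex_nu (phi A k) <-> convex_set A,
       pos_homogeneous_nu (phi A k) <-> cone A,
       subadditive_nu (phi A k) <-> sumset A A `<=` A,
       sublinear_nu (phi A k) <-> convex_set A /\ cone A
     & quasiconvex_nu (phi A k) <-> convex_nu (phi A k)]).
Proof.
have sublin : convex_set A /\ cone A -> sublinear_nu (phi A k).
  by move=> [cA coA]; split; [exact: phi_convex | exact: phi_pos_homogeneous].
split.
  split => //; [exact: phi_convex | exact: phi_pos_homogeneous |].
  exact: phi_subadditive.
move=> clA reck.
have A_section y : epi_nu (phi A k) (y, 0) <-> A y.
  by have := epi_phi_closedP y 0 clA reck; rewrite scale0r subr0.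
have qc := quasiconvex_phi_convex A_section.
have convex_nec : convex_nu (phi A k) -> convex_set A.
  by move=> /convex_quasiconvex.
have cone_nec := pos_homogeneous_phi_cone A_section.
split.
- by split => //; exact: phi_convex.
- by split => //; exact: phi_pos_homogeneous.
- by split; [exact: subadditive_phi_add | exact: phi_subadditive].
- by split => // -[/convex_nec ? /cone_nec ?].
- by split => [/qc/phi_convex|/convex_quasiconvex].
Qed.
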